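(* Let $n\ge1$ and let $\lambda_n\in[0,1]$ be a constant. 1. If $L_p(\mathbf{M}_+(I)\cap D)\subseteq\mathbf{M}_+(J)$ for every $p=1,\dots,n$, then $L_{n,\lambda_n}(\mathbf{M}_+(I)\cap D)\subseteq\mathbf{M}_+(J)$. 2. If $L_p(\mathbf{M}_+(I)\cap D)\subseteq\mathbf{M}_+(J)$ and $L_p(\mathbf{Cx}(I)\cap D)\subseteq\mathbf{Cx}(J)$ for every $p=1,\dots,n$, then $L_{n,\lambda_n}(\mathbf{Cx}(I)\cap D)\subseteq\mathbf{Cx}(J)$. 3. Let $K,H,\alpha>0$. If $L_p(\mathbf{Lip}_K(\alpha)(I)\cap D)\subseteq\mathbf{Lip}_H(\alpha)(J)$ for every $p=1,\dots,n$, then $L_{n,\lambda_n}(\mathbf{Lip}_K(\alpha)(I)\cap D)\subseteq\mathbf{Lip}_{K+H}(\alpha)(J)$. In particular (case $\alpha=1$), Lipschitz continuity is preserved by $L_{n,\lambda_n}$.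
   Context: $I$ is an interval of the real line and $J$ a subinterval of $I$. $F(J)$ is the space of all real functions on $J$, $C(I)$ the space of continuous real functions on $I$. $\mathbf 1$ is the constant function $1$ and $e_1(x)=x$. For $f\in C(I)$, $\alpha\in[0,1]$, $x\in I$, put $f_{\alpha,x}(t)=f(\alpha t+(1-\alpha)x)$, $t\in I$. $D$ is a sublattice (linear sublattice) of $C(I)$ such that $\mathbf 1,e_1\in D$ and $f_{\alpha,x}\in D$ for all $f\in D$, $x\in I$, $\alpha\in[0,1]$. $(L_n)_{n\ge1}$ is a sequence of positive linear operators $L_n:D\to F(J)$ with $L_n(\mathbf 1)=\mathbf 1$; $L_0(f):=f_{|J}$. For a constant $\lambda_n\in[0,1]$ (viewed as a constant function on $J$), $f\in D$, $x\in J$, $$L_{n,\lambda_n}(f)(x):=\sum_{p=0}^n\binom np\lambda_n^p(1-\lambda_n)^{n-p}L_p(f_{p/n,x})(x)$$ (with $0^0=1$). For an interval $A$ (here $A=I$ or $A=J$): $\mathbf{M}_+(A)$ is the set of increasing functions $f:A\to\mathbb{R}$ (i.e. $x\le y\Rightarrow f(x)\le f(y)$); $\mathbf{Cx}(A)$ is the set of convex functions $f:A\to\mathbb{R}$; and $\mathbf{Lip}_K(\alpha)(A)=\{f:A\to\mathbb{R}:\ |f(x)-f(y)|\le K|x-y|^\alpha\ \text{for all }x,y\in A\}$ for $K>0$, $\alpha>0$. *)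

(* Defs.v *)
From HB Require Import structures.
From mathcomp Require Import all_boot all_order all_algebra.
From mathcomp Require Import all_classical all_reals all_analysis lra.

Set Implicit Arguments.
Unset Strict Implicit.
Unset Printing Implicit Defensive.

Import Order.TTheory GRing.Theory Num.Theory.
Import numFieldNormedType.Exports.

Local Open Scope classical_set_scope.
Local Open Scope ring_scope.

Section defs.
Context {R : realType}.
Implicit Types (A I J : interval R).

Lemma itv_conv_subproof A (a : {i01 R}) (t x : [set` A]) :
  a%:num * val t + (1 - a%:num) * val x \in [set` A].
Proof.
have Ai := @interval_is_interval R A.
have [tA xA] : [set` A] (val t) /\ [set` A] (val x) by split; exact: set_valP.
have [a0 a1] : 0 <= a%:num /\ a%:num <= 1 by [].
apply: mem_set; have [tx|/ltW xt] := leP (val t) (val x).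
  by apply: (Ai (val t) (val x)) => //; apply/andP; split; nra.
by apply: (Ai (val x) (val t)) => //; apply/andP; split; nra.
Qed.

(* The point a t + (1 - a) x of the interval A. *)
Definition itv_conv A (a : {i01 R}) (t x : [set` A]) : [set` A] :=
  SigSub (itv_conv_subproof a t x).

Definition Mplus A : set ([set` A] -> R) :=
  [set f | forall x y : [set` A], val x <= val y -> f x <= f y].

Definition Cx A : set ([set` A] -> R) :=
  [set f | forall (a : {i01 R}) (x y : [set` A]),
    f (itv_conv a x y) <= a%:num * f x + (1 - a%:num) * f y].

Definition Lip (K alpha : R) A : set ([set` A] -> R) :=
  [set f | forall x y : [set` A],
    `|f x - f y| <= K * `|val x - val y| `^ alpha].

Definition Lipschitz A : set ([set` A] -> R) :=
  [set f | exists2 K : R, 0 < K & Lip K 1 f].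

(* contract f a x is the function f_{a,x} : t |-> f (a t + (1 - a) x). *)
Definition contract I (f : [set` I] -> R) (a : {i01 R}) (x : [set` I]) :
    [set` I] -> R :=
  fun t => f (itv_conv a t x).

Record admissible_sublattice I (D : set ([set` I] -> R)) : Prop := {
  adm_cont : forall f, D f -> continuous f ;
  adm_add : forall f g, D f -> D g -> D (f \+ g) ;
  adm_scale : forall (c : R) f, D f -> D (fun x => c * f x) ;
  adm_max : forall f g, D f -> D g -> D (f \max g) ;
  adm_min : forall f g, D f -> D g -> D (f \min g) ;
  adm_one : D (fun=> 1) ;
  adm_id : D (fun x => val x) ;
  adm_contract : forall f (x : [set` I]) (a : {i01 R}),
    D f -> D (contract f a x) }.

(* An operator with domain D is represented by a function on all of F(I);
   nothing is assumed about, nor does anything depend on, its values off D. *)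
Record positive_linear_unital I J (D : set ([set` I] -> R))
    (T : ([set` I] -> R) -> ([set` J] -> R)) : Prop := {
  plu_add : forall f g, D f -> D g -> T (f \+ g) = T f \+ T g ;
  plu_scale : forall (c : R) f, D f ->
    T (fun x => c * f x) = (fun x => c * T f x) ;
  plu_pos : forall f, D f -> (forall t, 0 <= f t) -> forall x, 0 <= T f x ;
  plu_one : T (fun=> 1) = (fun=> 1) }.

Lemma ratio_ge0 n (p : 'I_n.+1) : 0 <= p%:R / n%:R :> R.
Proof. by rewrite divr_ge0. Qed.

Lemma ratio_le1 n (p : 'I_n.+1) : p%:R / n%:R <= 1 :> R.
Proof.
case: n p => [|n] p; first by rewrite invr0 mulr0.
by rewrite ler_pdivrMr ?ltr0n// mul1r ler_nat -ltnS.
Qed.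

Definition ratio n (p : 'I_n.+1) : {i01 R} :=
  Itv01 (ratio_ge0 p) (ratio_le1 p).

(* The sequence L is only meaningful from index 1; index 0 is restriction. *)
Definition with_L0 I J (JI : [set` J] `<=` [set` I])
    (L : nat -> ([set` I] -> R) -> ([set` J] -> R)) (p : nat)
    (f : [set` I] -> R) : [set` J] -> R :=
  if p is 0%N then fun x => f (subfun JI x) else L p f.

Definition Lmix I J (JI : [set` J] `<=` [set` I])
    (L : nat -> ([set` I] -> R) -> ([set` J] -> R)) (n : nat) (lam : R)
    (f : [set` I] -> R) : [set` J] -> R :=
  fun x => \sum_(p < n.+1) 'C(n, p)%:R * lam ^+ p * (1 - lam) ^+ (n - p)
    * with_L0 JI L p (contract f (ratio p) (subfun JI x)) x.

End defs.

Arguments Mplus {R} A.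
Arguments Cx {R} A.
Arguments Lip {R} K alpha A.
Arguments Lipschitz {R} A.

(* Main.v *)
From Pilot Require Import Defs.
From mathcomp Require Import all_boot all_order all_algebra.
From mathcomp Require Import all_classical all_reals all_analysis.
From mathcomp Require Import ring lra.

Set Implicit Arguments.
Unset Strict Implicit.
Unset Printing Implicit Defensive.

Import Order.TTheory GRing.Theory Num.Theory.

Local Open Scope classical_set_scope.
Local Open Scope ring_scope.

Local Notation contract := Pilot.Defs.contract.

(** Write f_{a,x} for the function t |-> f (a t + (1 - a) x). At x the averaged
    operator is a binomial average, with constant weights of sum 1, of the
    diagonal values T (f_{a,x}) (x), where T is one of the operators and
    a = p / n. Monotony, convexity and Hoelder bounds pass to such averages
    ([avg_Mplus], [avg_Cx], [avg_Lip]), so it is enough to control each single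
    diagonal function x |-> T (f_{a,x}) (x). There x occurs twice, as the point
    of evaluation and as the centre of the contraction. The hypothesis on T
    governs the first occurrence, since f_{a,x} inherits from f the property
    in question; positivity of T and T 1 = 1 govern the second, since they
    transport pointwise inequalities between f_{a,x} and f_{a,y}. For
    increasing functions and for Hoelder bounds, where the two contributions H
    and K add up, it is enough to vary one occurrence after the other
    ([diagonal_Mplus], [diagonal_Lip]).

    For convex functions this only gives convexity in each occurrence
    separately, which does not imply convexity on the diagonal. The missing
    inequality, for x <= y, is
      T f_{a,x} (y) + T f_{a,y} (x) <= T f_{a,x} (x) + T f_{a,y} (y),
    that is, T (f_{a,y} - f_{a,x}) takes at x a value at most the one at y.
    Now f_{a,y} - f_{a,x} is increasing because f is convex
    ([contract_increment_Mplus]), and T preserves increasing functions: this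
    is how preservation of monotony enters the convex case ([diagonal_Cx]).

    The restriction to J, which is the operator of index 0, is itself positive
    and unital and preserves increasing and convex functions. For Hoelder
    bounds it has constant K instead of H, but it is only applied to the
    contraction of ratio 0, a constant function. *)

(** * Convex combinations in an interval *)

Section contract.
Variables (R : realType) (I : interval R).
Implicit Types (a b : {i01 R}) (f : [set` I] -> R) (s t x y z : [set` I]).

Lemma val_itv_conv a t x :
  val (itv_conv a t x) = a%:num * val t + (1 - a%:num) * val x.
Proof. by []. Qed.

Lemma itv_conv_idem a x : itv_conv a x x = x.
Proof. by apply: val_inj => /=; ring. Qed.

Lemma itv_conv0 a x t : a%:num = 0 -> itv_conv a t x = x.
Proof. by move=> a0; apply: val_inj; rewrite /= a0; ring. Qed.

Lemma itv_convACA a b s t x y :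
  itv_conv a (itv_conv b s t) (itv_conv b x y) =
  itv_conv b (itv_conv a s x) (itv_conv a t y).
Proof. by apply: val_inj => /=; ring. Qed.

Lemma onem_ge0_i01 a : 0 <= 1 - a%:num.
Proof. by rewrite subr_ge0. Qed.

Lemma le_itv_conv a s t x y : val s <= val t -> val x <= val y ->
  val (itv_conv a s x) <= val (itv_conv a t y).
Proof.
by move=> st xy; rewrite /= lerD// ler_wpM2l// onem_ge0_i01.
Qed.

Lemma contract_Mplus f a x : Mplus I f -> Mplus I (contract f a x).
Proof. by move=> fM s t st; apply/fM/le_itv_conv. Qed.

Lemma contract_Cx f a x : Cx I f -> Cx I (contract f a x).
Proof.
move=> fC b s t; rewrite /contract.
by rewrite -{1}[x](itv_conv_idem b) itv_convACA; exact: fC.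
Qed.

Lemma contract_convex f a b x y t : Cx I f ->
  contract f a (itv_conv b x y) t
    <= b%:num * contract f a x t + (1 - b%:num) * contract f a y t.
Proof.
move=> fC; rewrite /contract -{1}[t](itv_conv_idem b) itv_convACA.
exact: fC.
Qed.

Lemma contract_Lip (K alpha : R) f a x : 0 <= K -> 0 <= alpha ->
  Lip K alpha I f -> Lip K alpha I (contract f a x).
Proof.
move=> K0 alpha0 fL s t; apply: (le_trans (fL _ _)); rewrite ler_wpM2l//.
apply: ge0_ler_powR; rewrite ?nnegrE//.
have -> : val (itv_conv a s x) - val (itv_conv a t x)
  = a%:num * (val s - val t) by rewrite /=; ring.
by rewrite normrM ger0_norm// ler_piMl.
Qed.

Lemma contract_center_Lip (K alpha : R) f a x y t : 0 <= K -> 0 <= alpha ->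
  Lip K alpha I f ->
  `|contract f a x t - contract f a y t| <= K * `|val x - val y| `^ alpha.
Proof.
move=> K0 alpha0 fL; apply: (le_trans (fL _ _)); rewrite ler_wpM2l//.
apply: ge0_ler_powR; rewrite ?nnegrE//.
have -> : val (itv_conv a t x) - val (itv_conv a t y)
  = (1 - a%:num) * (val x - val y) by rewrite /=; ring.
by rewrite normrM ger0_norm ?onem_ge0_i01// ler_piMl// gerBl.
Qed.

(** Both inner points are convex combinations of the outer ones, with
    exchanged coefficients; adding the two convexity inequalities makes the
    coefficients disappear. *)
Lemma Cx_inner_outer f (u v m m' : [set` I]) : Cx I f ->
  val u <= val m <= val v -> val m + val m' = val u + val v ->
  f m + f m' <= f u + f v.
Proof.
move=> fC /andP[um mv] sumE.
have [uv|vu] := ltP (val u) (val v); last first.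
  have -> : m = u by apply: val_inj; lra.
  by have -> : m' = v by apply: val_inj; lra.
have d0 : 0 < val v - val u by rewrite subr_gt0.
have th0 : 0 <= (val v - val m) / (val v - val u).
  by rewrite divr_ge0 ?subr_ge0// ltW.
have th1 : (val v - val m) / (val v - val u) <= 1.
  by rewrite ler_pdivrMr// mul1r lerB.
have [th thE] : exists th : {i01 R},
    th%:num * (val v - val u) = val v - val m.
  by exists (Itv01 th0 th1); rewrite divfK// gt_eqF.
have mE : m = itv_conv th u v by apply: val_inj; rewrite val_itv_conv; lra.
have m'E : m' = itv_conv th v u by apply: val_inj; rewrite val_itv_conv; lra.
have := lerD (fC th u v) (fC th v u).
by rewrite -mE -m'E; lra.
Qed.

(** The two-variable function t, x |-> f (a t + (1 - a) x) is supermodular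
    when f is convex: its increment in x grows with t. *)
Lemma contract_increment_Mplus f a x y : Cx I f -> val x <= val y ->
  Mplus I (fun t => contract f a y t - contract f a x t).
Proof.
move=> fC xy s t st; rewrite /contract.
have := @Cx_inner_outer f (itv_conv a s x) (itv_conv a t y) (itv_conv a t x)
  (itv_conv a s y) fC.
rewrite !le_itv_conv// => /(_ isT).
have -> : val (itv_conv a t x) + val (itv_conv a s y) =
  val (itv_conv a s x) + val (itv_conv a t y) by rewrite /=; ring.
by move=> /(_ erefl); lra.
Qed.

End contract.

(** * Positive unital operators *)

Section operator.
Variables (R : realType) (I J : interval R) (D : set ([set` I] -> R)).
Hypothesis hD : admissible_sublattice D.
Implicit Types (f g : [set` I] -> R).

Lemma adm_lin (c d : R) f g : D f -> D g -> D (fun t => c * f t + d * g t).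
Proof.
by move=> Df Dg; apply: (adm_add hD (f := fun t => c * f t)
  (g := fun t => d * g t)); apply: (adm_scale hD).
Qed.

Lemma adm_sub f g : D f -> D g -> D (fun t => f t - g t).
Proof.
move=> Df Dg.
rewrite (_ : (fun t => _) = fun t => 1 * f t + (-1) * g t); first exact: adm_lin.
by apply/funext => t; ring.
Qed.

Lemma adm_cst (c : R) : D (fun=> c).
Proof.
rewrite (_ : (fun=> c) = fun=> c * 1 :> R).
  exact: (adm_scale hD _ (adm_one hD)).
by apply/funext => t; rewrite mulr1.
Qed.

Section plu.
Variable T : ([set` I] -> R) -> [set` J] -> R.
Hypothesis hT : positive_linear_unital D T.

Lemma plu_lin (c d : R) f g x : D f -> D g ->
  T (fun t => c * f t + d * g t) x = c * T f x + d * T g x.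
Proof.
move=> Df Dg; have := plu_add hT (adm_scale hD c Df) (adm_scale hD d Dg).
by rewrite (plu_scale hT)// (plu_scale hT)// => /(congr1 (@^~ x)).
Qed.

Lemma plu_sub f g x : D f -> D g -> T (fun t => f t - g t) x = T f x - T g x.
Proof.
move=> Df Dg.
rewrite (_ : (fun t => _) = fun t => 1 * f t + (-1) * g t).
  by rewrite plu_lin//; ring.
by apply/funext => t; ring.
Qed.

Lemma plu_cst (c : R) x : T (fun=> c) x = c.
Proof.
rewrite (_ : (fun=> c) = fun=> c * 1 :> R).
  by rewrite (plu_scale hT _ (adm_one hD)) (plu_one hT) mulr1.
by apply/funext => t; rewrite mulr1.
Qed.

Lemma plu_le f g x : D f -> D g -> (forall t, f t <= g t) -> T f x <= T g x.
Proof.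
move=> Df Dg fg; rewrite -subr_ge0 -plu_sub//.
by apply: (plu_pos hT); [exact: adm_sub|move=> t; rewrite subr_ge0].
Qed.

Lemma plu_dist f g (c : R) x : D f -> D g ->
  (forall t, `|f t - g t| <= c) -> `|T f x - T g x| <= c.
Proof.
move=> Df Dg fg; rewrite -plu_sub// ler_norml.
have DB := adm_sub Df Dg.
have bounds t : - c <= f t - g t <= c by rewrite -ler_norml.
rewrite -{1}(plu_cst (- c) x) -{2}(plu_cst c x).
by apply/andP; split; apply: plu_le => //; do ?exact: adm_cst;
  move=> t; have /andP[] := bounds t.
Qed.

Variable JI : [set` J] `<=` [set` I].
Notation iota := (subfun JI).

(** Moving the point of evaluation uses the monotonicity of the image,
    moving the centre of contraction uses positivity. *)
Lemma diagonal_Mplus f (a : {i01 R}) : T @` (Mplus I `&` D) `<=` Mplus J ->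
  D f -> Mplus I f -> Mplus J (fun x => T (contract f a (iota x)) x).
Proof.
move=> TM Df fM x y xy.
have Dc z : D (contract f a z) by exact: adm_contract.
apply: (@le_trans _ _ (T (contract f a (iota x)) y)).
  by apply: TM xy; exists (contract f a (iota x)) => //; split=> //;
    exact: contract_Mplus.
by apply: plu_le => // t; apply/fM/le_itv_conv.
Qed.

(** Convexity in the point of evaluation and in the centre separately bounds
    the value at b x + (1 - b) y by a quadratic form in b whose mixed terms
    are T f_{a,y} (x) and T f_{a,x} (y). They are absorbed by the diagonal
    terms because the function f_{a,y} - f_{a,x} is increasing if x <= y, and
    hence so is its image. *)
Lemma diagonal_Cx f (a : {i01 R}) : T @` (Mplus I `&` D) `<=` Mplus J ->
  T @` (Cx I `&` D) `<=` Cx J ->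
  D f -> Cx I f -> Cx J (fun x => T (contract f a (iota x)) x).
Proof.
move=> TM TC Df fC b x y; set z := itv_conv b x y.
have Dc w : D (contract f a w) by exact: adm_contract.
have zE : iota z = itv_conv b (iota x) (iota y) by exact: val_inj.
set F := fun w v : [set` J] => T (contract f a (iota w)) v.
have Fpoint : F z z <= b%:num * F z x + (1 - b%:num) * F z y.
  by apply: TC; exists (contract f a (iota z)) => //; split=> //;
    exact: contract_Cx.
have Fcentre v : F z v <= b%:num * F x v + (1 - b%:num) * F y v.
  rewrite /F -plu_lin//; apply: plu_le => //; first exact: adm_lin.
  by move=> t; rewrite zE; exact: contract_convex.
have mono u v : val u <= val v -> F u v + F v u <= F u u + F v v.
  move=> uv; have : T (fun t => contract f a (iota v) t
      - contract f a (iota u) t) u <= T (fun t => contract f a (iota v) t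
      - contract f a (iota u) t) v.
    apply: TM (uv); eexists; last by [].
    by split; [exact: contract_increment_Mplus|exact: adm_sub].
  by rewrite !plu_sub// /F; lra.
have mixed : F x y + F y x <= F x x + F y y.
  have [/mono//|/ltW/mono] := leP (val x) (val y).
  by rewrite addrC [X in _ <= X]addrC.
rewrite -/(F z z) -/(F x x) -/(F y y).
have b0 : 0 <= b%:num by [].
have b1 := onem_ge0_i01 b.
have hx := ler_wpM2l b0 (Fcentre x).
have hy := ler_wpM2l b1 (Fcentre y).
have hm := ler_wpM2l (mulr_ge0 b0 b1) mixed.
nra.
Qed.

Lemma diagonal_Lip f (a : {i01 R}) (K H alpha : R) : 0 <= K -> 0 <= alpha ->
  (forall z, Lip H alpha J (T (contract f a z))) ->
  D f -> Lip K alpha I f ->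
  Lip (K + H) alpha J (fun x => T (contract f a (iota x)) x).
Proof.
move=> K0 alpha0 TL Df fL x y.
have Dc z : D (contract f a z) by exact: adm_contract.
rewrite [K + H]addrC mulrDl.
apply: (le_trans (ler_distD (T (contract f a (iota x)) y) _ _)).
apply: lerD; first exact: TL.
by apply: plu_dist => // t; exact: contract_center_Lip.
Qed.

End plu.

Lemma plu_restriction (JI : [set` J] `<=` [set` I]) :
  positive_linear_unital D (fun f x => f (subfun JI x)).
Proof. by split. Qed.

Section rescale.
Variable T : ([set` I] -> R) -> [set` J] -> R.
Hypothesis hT : positive_linear_unital D T.

(** Homogeneity of T turns a bound for the functions of one constant K into a
    bound for all the functions with a constant, as needed for Lipschitz
    functions of unspecified constant. *)
Lemma plu_Lip_rescale (K K' H alpha : R) : 0 < K -> 0 < K' ->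
  T @` (Lip K alpha I `&` D) `<=` Lip H alpha J ->
  T @` (Lip K' alpha I `&` D) `<=` Lip (K' / K * H) alpha J.
Proof.
move=> K0 K'0 TL _ [f [fL Df] <-] x y.
have c0 : 0 < K / K' by rewrite divr_gt0.
have gL : Lip K alpha I (fun t => K / K' * f t).
  move=> s t; rewrite -mulrBr normrM gtr0_norm//.
  apply: le_trans (ler_wpM2l (ltW c0) (fL s t)) _.
  by rewrite mulrA divfK ?gt_eqF.
have : Lip H alpha J (T (fun t => K / K' * f t)).
  by apply: TL; eexists; last by []; split=> //; exact: adm_scale.
rewrite (plu_scale hT)// => /(_ x y); rewrite -mulrBr normrM gtr0_norm//.
rewrite -(ler_pM2l (_ : 0 < K' / K)) ?divr_gt0// !mulrA.
by rewrite (_ : K' / K * K / K' = 1) ?mul1r//; field; rewrite !gt_eqF.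
Qed.

End rescale.
End operator.

(** * Binomial averages *)

Section binomial_average.
Variable R : realType.
Variables (n : nat) (lam : R).
Hypothesis hlam : 0 <= lam <= 1.

Let w (p : 'I_n.+1) : R := 'C(n, p)%:R * lam ^+ p * (1 - lam) ^+ (n - p).

Let w_ge0 p : 0 <= w p.
Proof. by case/andP: hlam => l0 l1; rewrite !mulr_ge0// exprn_ge0// subr_ge0. Qed.

Let sum_w : \sum_p w p = 1.
Proof.
rewrite -[RHS](expr1n _ n) -[in RHS](subrK lam 1) exprDn.
by apply: eq_bigr => p _; rewrite /w -mulr_natl; ring.
Qed.

Variables (J : interval R) (g : 'I_n.+1 -> [set` J] -> R).
Let avg x := \sum_p w p * g p x.

Lemma avg_Mplus : (forall p, Mplus J (g p)) -> Mplus J avg.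
Proof.
by move=> gM x y xy; apply: ler_sum => p _; rewrite ler_wpM2l//; exact: gM.
Qed.

Lemma avg_Cx : (forall p, Cx J (g p)) -> Cx J avg.
Proof.
move=> gC a x y; rewrite /avg !mulr_sumr -big_split; apply: ler_sum => p _ /=.
rewrite (_ : _ + _ = w p * (a%:num * g p x + (1 - a%:num) * g p y)); last ring.
by rewrite ler_wpM2l//; exact: gC.
Qed.

Lemma avg_Lip (K alpha : R) :
  (forall p, Lip K alpha J (g p)) -> Lip K alpha J avg.
Proof.
move=> gL x y; rewrite /avg -sumrB -[leRHS]mul1r -sum_w mulr_suml.
apply: le_trans (ler_norm_sum _ _ _) _; apply: ler_sum => p _.
by rewrite -mulrBr normrM ger0_norm// ler_wpM2l//; exact: gL.
Qed.

End binomial_average.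

Theorem proposition3p3 (R : realType) (I J : interval R)
    (JI : [set` J] `<=` [set` I])
    (D : set ([set` I] -> R)) (hD : admissible_sublattice D)
    (L : nat -> ([set` I] -> R) -> ([set` J] -> R))
    (hL : forall m : nat, (1 <= m)%N -> positive_linear_unital D (L m))
    (n : nat) (hn : (1 <= n)%N) (lam : R) (hlam : 0 <= lam <= 1) :
  [/\ (forall p : nat, (1 <= p <= n)%N ->
          L p @` (Mplus I `&` D) `<=` Mplus J) ->
        Lmix JI L n lam @` (Mplus I `&` D) `<=` Mplus J,
      (forall p : nat, (1 <= p <= n)%N ->
          L p @` (Mplus I `&` D) `<=` Mplus J /\
          L p @` (Cx I `&` D) `<=` Cx J) ->
        Lmix JI L n lam @` (Cx I `&` D) `<=` Cx J,
      forall K H alpha : R, 0 < K -> 0 < H -> 0 < alpha ->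
        (forall p : nat, (1 <= p <= n)%N ->
          L p @` (Lip K alpha I `&` D) `<=` Lip H alpha J) ->
        Lmix JI L n lam @` (Lip K alpha I `&` D)
          `<=` Lip (K + H) alpha J
    & forall K H : R, 0 < K -> 0 < H ->
        (forall p : nat, (1 <= p <= n)%N ->
          L p @` (Lip K 1 I `&` D) `<=` Lip H 1 J) ->
        Lmix JI L n lam @` (Lipschitz I `&` D) `<=` Lipschitz J].
Proof.
have hT p : positive_linear_unital D (with_L0 JI L p).
  by case: p => [|p]; [exact: plu_restriction|exact: hL].
have part3 (K H alpha : R) : 0 < K -> 0 < H -> 0 < alpha ->
    (forall p : nat, (1 <= p <= n)%N ->
      L p @` (Lip K alpha I `&` D) `<=` Lip H alpha J) ->
    Lmix JI L n lam @` (Lip K alpha I `&` D) `<=` Lip (K + H) alpha J.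
  move=> K0 H0 alpha0 LL _ [f [fL Df] <-]; apply: avg_Lip => // -[p pn].
  apply: (diagonal_Lip hD (hT p)) (fL) => //; do ?exact: ltW.
  move=> z; case: p pn => [|p] pn /=.
    (* At index 0 the constant H need not suit all of Lip K alpha I, but only
       the constant functions f_{0,z} matter. *)
    move=> x y; rewrite /contract !itv_conv0/= ?mul0r// subrr normr0.
    by rewrite mulr_ge0 ?powR_ge0// ltW.
  apply: (LL p.+1) => //; eexists; last by [].
  by split; [apply: contract_Lip; rewrite // ltW|exact: adm_contract].
split => //.
- move=> LM _ [f [fM Df] <-]; apply: avg_Mplus => // -[p pn].
  apply: (diagonal_Mplus hD (hT p)) fM => //.
  case: p pn => [|p] pn; last exact: LM.
  by move=> _ [g [gM _] <-] x y xy; exact: gM.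
- move=> LMC _ [f [fC Df] <-]; apply: avg_Cx => // -[p pn].
  apply: (diagonal_Cx hD (hT p)) fC => //; case: p pn => [|p] pn.
  + by move=> _ [g [gM _] <-] x y xy; exact: gM.
  + by have [] := LMC p.+1 pn.
  + move=> _ [g [gC _] <-] a x y /=.
    by rewrite (_ : subfun JI _ = itv_conv a (subfun JI x) (subfun JI y));
      [exact: gC|exact: val_inj].
  + by have [] := LMC p.+1 pn.
- move=> K H K0 H0 LL _ [f [[K' K'0 fL] Df] <-].
  exists (K' + K' / K * H); first by rewrite addr_gt0// mulr_gt0// divr_gt0.
  apply: (part3 K' (K' / K * H) 1) => //; last by exists f.
    by rewrite mulr_gt0// divr_gt0.
  move=> p /[dup] /andP[p0 _] /LL LLp.
  exact: (plu_Lip_rescale hD (hL _ p0) K0 K'0 LLp).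
Qed.
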